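(* We have $A(1)=\frac13$. Moreover, a Borel probability measure $\mu$ on $\mathbb{S}^1$ satisfies $\mathbb{P}_\mu(\ell<1)=\frac13$ if and only if $\mu(\{p\})=0$ for every $p\in\mathbb{S}^1$.
   Context: $\mathbb{S}^1\subset\mathbb{R}^2$ is the unit circle centered at the origin, and $\mathcal{M}(\mathbb{S}^1)$ is the set of Borel probability measures on $\mathbb{S}^1$. For $x,y\in\mathbb{S}^1$ with $x\ne y$, $\operatorname{aff}(x,y)$ is the line through $x$ and $y$; $\operatorname{aff}(x,x)$ is the tangent line to $\mathbb{S}^1$ at $x$. Define $f:(\mathbb{S}^1)^4\to[0,\infty]$ by: $f(x_1,x_2,x_3,x_4)=\|x_0\|_2$ if $\operatorname{aff}(x_1,x_2)\cap\operatorname{aff}(x_3,x_4)=\{x_0\}$ is a single point; $f(x_1,x_2,x_3,x_4)=$ the Euclidean distance from the line $\operatorname{aff}(x_1,x_2)$ to the origin if $\operatorname{aff}(x_1,x_2)=\operatorname{aff}(x_3,x_4)$; $f(x_1,x_2,x_3,x_4)=\infty$ if $\operatorname{aff}(x_1,x_2)\cap\operatorname{aff}(x_3,x_4)=\emptyset$. For $\mu\in\mathcal{M}(\mathbb{S}^1)$, $\mathbb{P}_\mu(\ell<r):=\mu^{\otimes 4}(\{f<r\})$, i.e. $\ell=f(X_1,X_2,X_3,X_4)$ with $X_i$ independent and $\mu$-distributed. For $0\le r\le1$, $A(r)=\sup_{\mu\in\mathcal{M}(\mathbb{S}^1)}\mathbb{P}_\mu(\ell<r)$. *)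

(* Defs.v *)
From HB Require Import structures.
From mathcomp Require Import all_boot all_order all_algebra.
From mathcomp Require Import all_classical all_reals all_analysis.
Import Order.TTheory GRing.Theory Num.Theory.
Import numFieldNormedType.Exports.

Set Implicit Arguments.
Unset Strict Implicit.
Unset Printing Implicit Defensive.

Local Open Scope classical_set_scope.
Local Open Scope ring_scope.

(* The library norm on [R * R] is the sup norm, so the Euclidean norm has to
   be defined; both induce the product topology used below. *)
Definition enorm2 (R : realType) (x : R * R) : R :=
  Num.sqrt (x.1 ^+ 2 + x.2 ^+ 2).

Definition unit_circle (R : realType) : set (R * R) := [set x | enorm2 x = 1].
Arguments unit_circle : clear implicits.

Lemma unit_circle10 (R : realType) : unit_circle R (1, 0).
Proof. by rewrite /unit_circle /enorm2 /= expr1n expr0n /= addr0 sqrtr1. Qed.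

Definition circle (R : realType) : Type := set_type (unit_circle R).

(* [circle R] carries the subspace topology inherited from [R * R]. *)
HB.instance Definition _ (R : realType) :=
  Topological.copy (circle R) (set_type (unit_circle R)).
HB.instance Definition _ (R : realType) :=
  isPointed.Build (circle R) (SigSub (mem_set (unit_circle10 R))).

Definition borel_circle (R : realType) : Type :=
  g_sigma_algebraType (@open (circle R)).

Definition line_through (R : realType) (x y : R * R) : set (R * R) :=
  [set z | exists t : R, z = (1 - t) *: x + t *: y].

(* For [x] on the unit circle the radius at [x] is [x] itself, so the tangent
   at [x] is the line through [x] orthogonal to [x]. *)
Definition tangent_line (R : realType) (x : R * R) : set (R * R) :=
  [set z | (z.1 - x.1) * x.1 + (z.2 - x.2) * x.2 = 0].

Definition aff (R : realType) (x y : circle R) : set (R * R) :=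
  if x == y then tangent_line (val x) else line_through (val x) (val y).

Definition dist_origin (R : realType) (L : set (R * R)) : R :=
  inf [set enorm2 z | z in L].

(* Two lines of the plane meet in a single point, coincide or are disjoint;
   the final [+oo] is the disjoint case. *)
Definition ell (R : realType) (x1 x2 x3 x4 : circle R) : \bar R :=
  match pselect (exists x0, aff x1 x2 `&` aff x3 x4 = [set x0]) with
  | left H => (enorm2 (sval (cid H)))%:E
  | right _ => if `[< aff x1 x2 = aff x3 x4 >]
               then (dist_origin (aff x1 x2))%:E else +oo%E
  end.

(* [mu \x mu \x mu \x mu] associates to the left. *)
Definition prob_ell_lt (R : realType) (mu : probability (borel_circle R) R)
    (r : R) : \bar R :=
  (mu \x mu \x mu \x mu)%E
    [set x | (ell x.1.1.1 x.1.1.2 x.1.2 x.2 < r%:E)%E].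

Definition sup_prob (R : realType) (r : R) : \bar R :=
  ereal_sup [set prob_ell_lt mu r | mu in [set: probability (borel_circle R) R]].

(* Main.v *)
(* For distinct points, [ell < 1] means that the chords [X1 X2] and [X3 X4]
   cross.  Four distinct points of the circle can be paired
   in three ways, exactly one of which gives crossing chords, so without atoms
   exchangeability gives probability 1/3.  With atoms, comparing indicators
   pointwise over the three pairings and all coincidence patterns and then
   integrating gives, for [m x = mu {x}],
     3 P(ell < 1) + 3 E[m^2] + P(X1 = X2 = X3 = X4) <= 1 + 3 (E[m])^2,
   and [(E[m])^2 <= E[m^2]] leaves 3 P(ell < 1) + P(X1 = ... = X4) <= 1.
   Hence P <= 1/3, and equality forbids atoms. *)
Require Import Defs.
From mathcomp Require Import all_boot all_order all_algebra.
From mathcomp Require Import all_classical all_reals all_analysis measurable_realfun.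
From mathcomp Require Import ring lra.
Import Order.TTheory GRing.Theory Num.Theory.
Import numFieldNormedType.Exports.

Local Open Scope classical_set_scope.
Local Open Scope ring_scope.

(** Twice the signed area of the triangle [a b c]: zero for collinear points, and otherwise its sign
    tells on which side of the line [a b] the point [c] lies. *)
Definition orient {R : realType} (a b c : R * R) : R :=
  (b.1 - a.1) * (c.2 - a.2) - (b.2 - a.2) * (c.1 - a.1).

(** * Lines and chords of the unit circle in coordinates *)

Section Geometry.
Variable R : realType.
Implicit Types (x y z : R * R) (a b c d p : circle R).

Definition norm2 x : R := x.1 ^+ 2 + x.2 ^+ 2.

Lemma enorm2_lt1 z : (enorm2 z < 1) = (norm2 z < 1).
Proof. by rewrite /enorm2 -[X in _ < X]sqrtr1 ltr_sqrt ?ltr01. Qed.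

Lemma circleE a : norm2 (val a) = 1.
Proof.
have : unit_circle R (val a) by exact: set_valP.
rewrite /unit_circle /= /enorm2 /norm2 => h.
have : Num.sqrt ((val a).1 ^+ 2 + (val a).2 ^+ 2) ^+ 2 = 1 by rewrite h expr1n.
by rewrite sqr_sqrtr // addr_ge0 ?sqr_ge0.
Qed.

Definition dist2 x y : R := (x.1 - y.1) ^+ 2 + (x.2 - y.2) ^+ 2.

Lemma dist2_gt0 x y : x != y -> 0 < dist2 x y.
Proof.
move=> xy; rewrite /dist2 lt_def addr_ge0 ?sqr_ge0// andbT.
apply: contra_neq xy => /eqP; rewrite paddr_eq0 ?sqr_ge0// !sqrf_eq0 !subr_eq0.
by case: x y => [? ?] [? ?] /= /andP[/eqP -> /eqP ->].
Qed.

Lemma val_neq a b : a != b -> val a != val b.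
Proof. by apply: contra_neq; exact: val_inj. Qed.

Lemma segE x y (t : R) :
  (1 - t) *: x + t *: y = ((1 - t) * x.1 + t * y.1, (1 - t) * x.2 + t * y.2).
Proof. by case: x y => [? ?] [? ?]. Qed.

Lemma line_throughE x y z : x != y -> line_through x y z <-> orient x y z = 0.
Proof.
move=> xy; have := dist2_gt0 _ _ xy; rewrite /dist2 /orient => D0; split.
  by case=> t ->; rewrite segE /=; ring.
(* The parameter of the orthogonal projection of [z] onto the line. Below, [e1] and [e2] hold
   because their two sides differ by a multiple of the orientation, which [h] makes zero. *)
move=> h; exists (((z.1 - x.1) * (y.1 - x.1) + (z.2 - x.2) * (y.2 - x.2)) /
  ((x.1 - y.1) ^+ 2 + (x.2 - y.2) ^+ 2)).
have Dn : (x.1 - y.1) ^+ 2 + (x.2 - y.2) ^+ 2 != 0 by rewrite gt_eqF.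
rewrite segE {xy}; case: x y z h D0 Dn => [x1 x2] [y1 y2] [z1 z2] /= h D0 Dn.
set D := (_ ^+ 2 + _ ^+ 2) in D0 Dn *.
set n := (X in X / D).
have e1 : D * z1 = (D - n) * x1 + n * y1.
  transitivity ((D - n) * x1 + n * y1 + ((y1 - x1) * (z2 - x2) - (y2 - x2) * (z1 - x1)) * (x2 - y2)).
    by rewrite /D /n; ring.
  by rewrite h mul0r addr0.
have e2 : D * z2 = (D - n) * x2 + n * y2.
  transitivity ((D - n) * x2 + n * y2 - ((y1 - x1) * (z2 - x2) - (y2 - x2) * (z1 - x1)) * (x1 - y1)).
    by rewrite /D /n; ring.
  by rewrite h mul0r subr0.
clearbody D n.
congr pair; apply: (mulfI Dn); rewrite ?e1 ?e2; by field.
Qed.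

(** A quadratic in [t] with leading coefficient [dist2 (val a) (val b)] and value 1 at both [t = 0]
    and [t = 1]. *)
Lemma seg_norm a b (t : R) :
  norm2 ((1 - t) *: val a + t *: val b) = 1 - t * (1 - t) * dist2 (val a) (val b).
Proof.
rewrite segE /dist2 /norm2 /=.
have := circleE a; have := circleE b; rewrite /norm2.
set a1 := (val a).1; set a2 := (val a).2; set b1 := (val b).1; set b2 := (val b).2.
move=> hb ha.
transitivity ((1 - t) * (a1 ^+ 2 + a2 ^+ 2) + t * (b1 ^+ 2 + b2 ^+ 2)
  - t * (1 - t) * ((a1 - b1) ^+ 2 + (a2 - b2) ^+ 2)); first by ring.
by rewrite ha hb; ring.
Qed.

(** By [seg_norm], norm 1 on the line forces [t * (1 - t) = 0]. *)
Lemma line_circle a b c : a != b -> line_through (val a) (val b) (val c) ->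
  c = a \/ c = b.
Proof.
move=> ab [t ht].
have := seg_norm a b t; rewrite -ht circleE.
have D0 := dist2_gt0 _ _ (val_neq _ _ ab).
move=> /eqP; rewrite eq_sym subr_eq addrC -subr_eq subrr eq_sym.
rewrite mulf_eq0 (gt_eqF D0) orbF mulf_eq0 subr_eq0.
case/orP => /eqP t0; [left|right]; apply: val_inj; rewrite ht.
  by rewrite t0 subr0 scale1r scale0r addr0.
by rewrite -t0 subrr scale1r scale0r add0r.
Qed.

Lemma orient_eq0 a b c : (orient (val a) (val b) (val c) == 0) =
  [|| a == b, a == c | b == c].
Proof.
apply/eqP/idP => [h|]; last first.
  by case/or3P => /eqP ->; rewrite /orient; ring.
case: eqVneq => //= ab.
have [->|->] := line_circle _ _ c ab ((line_throughE _ _ _ (val_neq _ _ ab)).2 h).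
  by rewrite eqxx.
by rewrite eqxx orbT.
Qed.

(** * Crossing chords and the pointwise inequalities over the three pairings *)

(** For points of the circle, strict separation of [c] and [d] by the line [a b] amounts to crossing
    of the chords, since the line meets the open disc exactly in the open chord. *)
Definition cross a b c d : bool :=
  orient (val a) (val b) (val c) * orient (val a) (val b) (val d) < 0.

(** The combinatorial form of [ell < 1]. The second disjunct is a chord taken twice, whose line
    passes through the open disc. Distinct chords sharing an endpoint meet only on the circle, and
    tangents avoid the open disc, so neither counts. *)
Definition hit a b c d : bool :=
  cross a b c d ||
  ((a != b) && (((a == c) && (b == d)) || ((a == d) && (b == c)))).

Lemma cross_neq a b c d : cross a b c d ->
  [&& a != b, a != c, a != d, b != c, b != d & c != d].
Proof.
rewrite /cross => h.
have /norP[] : ~~ ((orient (val a) (val b) (val c) == 0) || (orient (val a) (val b) (val d) == 0)).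
  by rewrite -mulf_eq0 lt_eqF.
rewrite !orient_eq0 !negb_or => /and3P[-> -> ->] /and3P[_ -> ->] /=.
by apply: contraTneq h => ->; rewrite -expr2 -leNgt sqr_ge0.
Qed.

(* Inversion at [a] maps the circle to a line; this is the resulting linear
   dependency of the images of [b], [c], [d]. *)
Lemma orient_dist2 a b c d :
  orient (val a) (val b) (val c) * dist2 (val a) (val d) +
  orient (val a) (val c) (val d) * dist2 (val a) (val b) =
  orient (val a) (val b) (val d) * dist2 (val a) (val c).
Proof.
have := circleE a; have := circleE b; have := circleE c; have := circleE d.
rewrite /norm2 /orient /dist2; case: (val a) (val b) (val c) (val d)
  => [a1 a2] [b1 b2] [c1 c2] [d1 d2] /= hd hc hb ha.
(* With [E] the squared distances become [2 a . (a - x)], and the claim is the dependency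
   [det(u,v) w + det(v,w) u = det(u,w) v] of the plane vectors [u = b - a], [v = c - a],
   [w = d - a], paired with [-2 a]. *)
have E (x1 x2 : R) : x1 ^+ 2 + x2 ^+ 2 = 1 ->
  (a1 - x1) ^+ 2 + (a2 - x2) ^+ 2 = 2 * (a1 ^+ 2 + a2 ^+ 2) - 2 * (a1 * x1 + a2 * x2).
  rewrite -[X in _ = X -> _]ha => hx; transitivity ((a1 ^+ 2 + a2 ^+ 2) + (x1 ^+ 2 + x2 ^+ 2) -
    2 * (a1 * x1 + a2 * x2)); first by ring.
  by rewrite hx; ring.
by rewrite !E//; ring.
Qed.

(** With [w], [x], [y] the orientations of [abc], [abd], [acd], the three crossings read
    [w * x < 0], [w * y > 0] and [x * y < 0]. The relation [orient_dist2], whose distances are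
    positive, excludes that [w] and [y] share a sign while [x] has the opposite one. Each of the
    other six sign patterns satisfies exactly one condition. *)
Lemma cross_distinct a b c d :
  [&& a != b, a != c, a != d, b != c, b != d & c != d] ->
  (cross a b c d + cross a c b d + cross a d b c = 1)%N.
Proof.
case/and5P => ab ac ad bc /andP[bd cd].
have := orient_dist2 a b c d.
have := dist2_gt0 _ _ (val_neq _ _ ab); have := dist2_gt0 _ _ (val_neq _ _ ac).
have := dist2_gt0 _ _ (val_neq _ _ ad).
have ow : orient (val a) (val b) (val c) != 0.
  by rewrite orient_eq0 (negbTE ab) (negbTE ac) (negbTE bc).
have ox : orient (val a) (val b) (val d) != 0.
  by rewrite orient_eq0 (negbTE ab) (negbTE ad) (negbTE bd).
have oy : orient (val a) (val c) (val d) != 0.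
  by rewrite orient_eq0 (negbTE ac) (negbTE ad) (negbTE cd).
have oC x y z : orient x y z = - orient x z y by rewrite /orient; ring.
rewrite /cross (oC _ (val c) (val b)) (oC _ (val d) (val b)) (oC _ (val d) (val c)).
move: ow ox oy; move: (orient _ _ _) => w; move: (orient _ _ _) => x.
move: (orient _ _ _) => y; move: (dist2 _ _) => D; move: (dist2 _ _) => C.
move: (dist2 _ _) => B; move=> w0 x0 y0 D0 C0 B0 e.
rewrite mulrNN mulNr oppr_lt0.
have [w1|w1|] := ltgtP w 0; last by move=> e0; rewrite e0 eqxx in w0.
all: have [x1|x1|] := ltgtP x 0; last by move=> e0; rewrite e0 eqxx in x0.
all: have [y1|y1|] := ltgtP y 0; last by move=> e0; rewrite e0 eqxx in y0.
all: (first [rewrite (nmulr_rlt0 _ w1) (nmulr_rgt0 _ w1)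
  | rewrite (pmulr_rlt0 _ w1) (pmulr_rgt0 _ w1)]).
all: (first [rewrite (nmulr_rlt0 _ x1) | rewrite (pmulr_rlt0 _ x1)]).
all: rewrite ?x1 ?y1 ?(lt_gtF x1) ?(lt_gtF y1) //.
- exfalso; have := nmulr_rlt0 D w1; have := nmulr_rlt0 B y1; have := pmulr_rgt0 C x1.
  by rewrite B0 C0 D0; lra.
- exfalso; have := pmulr_rgt0 D w1; have := pmulr_rgt0 B y1; have := nmulr_rlt0 C x1.
  by rewrite B0 C0 D0; lra.
Qed.

(** The coefficients make this tight: both sides are 1 for distinct points and for exactly three
    equal points including [a], 2 for two different pairs of equal points, and 4 when all coincide.
    Any coincidence rules out every crossing, and the rest is a propositional consequence of the
    transitivity of equality. *)
Lemma hit_le a b c d :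
  (hit a b c d + ((a == c) && (a == d)) + (hit a c b d + ((a == b) && (a == d)))
   + (hit a d b c + ((a == b) && (a == c))) + [&& a == b, a == c & a == d]
   <= 1 + (((a == b) && (c == d)) + ((a == c) && (b == d)) + ((a == d) && (b == c))))%N.
Proof.
have [|N] := boolP [&& a != b, a != c, a != d, b != c, b != d & c != d].
  move=> H; have := cross_distinct _ _ _ _ H; rewrite /hit.
  case/and5P: H => /negbTE-> /negbTE-> /negbTE-> /negbTE-> /andP[/negbTE-> /negbTE->].
  by rewrite !(eq_sym c b, eq_sym d b, eq_sym d c) /= !orbF !addn0 => ->.
have K p q r s : [|| p == q, p == r, p == s, q == r, q == s | r == s] ->
  cross p q r s = false.
  by apply: contraTF => /cross_neq; rewrite !negb_or.
have N' : [|| a == b, a == c, a == d, b == c, b == d | c == d].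
  by apply: contraNT N; rewrite !negb_or.
have tr p q r : (p == q) && (q == r) ==> (p == r).
  by apply/implyP => /andP[/eqP -> /eqP ->].
rewrite /hit !K//; last 2 first.
- by move: N'; rewrite !(eq_sym d b, eq_sym d c); do 6!case: (_ == _).
- by move: N'; rewrite !(eq_sym c b); do 6!case: (_ == _).
move: (tr a b c) (tr a b d) (tr a c b) (tr a c d) (tr a d b) (tr a d c).
rewrite !(eq_sym c b, eq_sym d b, eq_sym d c).
move: (tr b a c) (tr b a d) (tr b c d) (tr b d c) (tr c b d) (tr c a d).
rewrite !(eq_sym c b, eq_sym d b, eq_sym d c, eq_sym b a, eq_sym c a, eq_sym d a).
by do 6!case: (_ == _).
Qed.

(** Counterpart for the lower bound: any coincidence contributes 1 by itself, and without one
    [cross_distinct] applies. *)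
Lemma le_hit a b c d :
  (1 <= hit a b c d + (a == b) + (c == d) + (hit a c b d + (a == c) + (b == d))
   + (hit a d b c + (a == d) + (b == c)))%N.
Proof.
have [|] := boolP [&& a != b, a != c, a != d, b != c, b != d & c != d].
  move=> H; have := cross_distinct _ _ _ _ H; rewrite /hit.
  case/and5P: H => /negbTE-> /negbTE-> /negbTE-> /negbTE-> /andP[/negbTE-> /negbTE->].
  by rewrite !(eq_sym c b, eq_sym d b, eq_sym d c) /= !orbF !addn0 => ->.
apply: contraNT; rewrite lt0n negbK !addn_eq0 !eqb0.
by do 6![case: (_ != _); rewrite ?andbF //=].
Qed.

(** * From the position of the two lines to crossing chords *)

Lemma aff_l a b : aff a b (val a).
Proof.
rewrite /aff; case: ifP => _; first by rewrite /tangent_line /= !subrr !mul0r addr0.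
by exists 0; rewrite subr0 scale1r scale0r addr0.
Qed.

Lemma affC a b : aff a b = aff b a.
Proof.
rewrite /aff eq_sym; case: eqVneq => [->//|_].
by apply/seteqP; split => z [t ->]; exists (1 - t); rewrite subKr addrC.
Qed.

Lemma aff_r a b : aff a b (val b).
Proof. by rewrite affC; exact: aff_l. Qed.

Lemma aff_neqE a b : a != b -> aff a b = line_through (val a) (val b).
Proof. by rewrite /aff => /negbTE ->. Qed.

(** Pythagoras: [z - a] is orthogonal to the radius at [a], so [norm2 z] is 1 plus the squared
    distance from [a] to [z]. *)
Lemma tangent_norm a z : aff a a z -> 1 <= norm2 z.
Proof.
rewrite /aff eqxx /tangent_line /norm2 /= => h.
have := circleE a; rewrite /norm2 /=.
move: h; case: z (sval a) => [z1 z2] [a1 a2] /= h ha.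
have -> : z1 ^+ 2 + z2 ^+ 2 = (z1 - a1) ^+ 2 + (z2 - a2) ^+ 2 + (a1 ^+ 2 + a2 ^+ 2) +
  2 * ((z1 - a1) * a1 + (z2 - a2) * a2) by ring.
by rewrite h ha mulr0 addr0 lerDr addr_ge0 ?sqr_ge0.
Qed.

Lemma norm2_lt1_neq a b z : aff a b z -> norm2 z < 1 -> a != b.
Proof.
by move=> abz; apply: contraTneq => ab; rewrite -leNgt (tangent_norm b)// -{1}ab.
Qed.

Lemma norm2_seg_lt1 a b (t : R) : a != b ->
  (norm2 ((1 - t) *: val a + t *: val b) < 1) = (0 < t < 1).
Proof.
move=> ab; rewrite seg_norm gtrBl (pmulr_lgt0 _ (dist2_gt0 _ _ (val_neq _ _ ab))).
apply/idP/idP => [h|/andP[t0 t1]]; last by rewrite mulr_gt0 ?subr_gt0.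
by apply/andP; split; nra.
Qed.

Lemma orient_seg x y z w (s : R) :
  orient x y ((1 - s) *: z + s *: w) = (1 - s) * orient x y z + s * orient x y w.
Proof. by rewrite segE /orient /=; ring. Qed.

Lemma hit_same a b c d : a != b -> c != d -> aff a b (val c) -> aff a b (val d) ->
  hit a b c d.
Proof.
move=> ab cd; rewrite aff_neqE// => /(line_circle _ _ _ ab) hc /(line_circle _ _ _ ab) hd.
rewrite /hit ab; move: hc hd cd.
by case=> -> [] ->; rewrite ?eqxx ?orbT ?andbT ?orbT.
Qed.

Lemma dist_origin_lt1 (L : set (R * R)) : L !=set0 ->
  dist_origin L < 1 <-> exists2 z, L z & norm2 z < 1.
Proof.
move=> L0; have hi : has_inf [set enorm2 z | z in L].
  split; first by case: L0 => z Lz; exists (enorm2 z); exists z.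
  by exists 0 => _ [z _ <-]; exact: sqrtr_ge0.
rewrite /dist_origin; split.
  by move=> /(inf_lt hi.1)[_ [z Lz <-]]; rewrite enorm2_lt1; exists z.
move=> [z Lz]; rewrite -enorm2_lt1; apply: le_lt_trans.
by apply: (ge_inf hi.2); exists z.
Qed.

(** Tangents miss the open disc, so [ell < 1] forces two chord lines. A meeting point with parameter
    [s] on [c d] solves [(1 - s) * u + s * v = 0], where [u] and [v] are the orientations of [c] and
    [d] against [a b]. It is inside the disc exactly when [0 < s < 1], which for nonzero [u] and [v]
    says that they have opposite signs. *)
Lemma ell_lt1 a b c d : (ell a b c d < 1%:E)%E <-> hit a b c d.
Proof.
rewrite /ell; case: pselect => [H|H].
  case: cid => x0 /= hx0; rewrite lte_fin enorm2_lt1.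
  have [abx cdx] : (aff a b `&` aff c d) x0 by rewrite hx0.
  split.
    move=> x1.
    have ab := norm2_lt1_neq _ _ _ abx x1; have cd := norm2_lt1_neq _ _ _ cdx x1.
    have : line_through (val c) (val d) x0 by rewrite -aff_neqE.
    case=> s es.
    have : line_through (val a) (val b) x0 by rewrite -aff_neqE.
    rewrite (line_throughE _ _ _ (val_neq _ _ ab)) es orient_seg => e.
    move: x1; rewrite es (norm2_seg_lt1 _ _ _ cd) => /andP[s0 s1].
    case: (boolP (cross a b c d)) => [|nc]; first by rewrite /hit => ->.
    (* Both weights are positive and [u * v >= 0]; multiplying the vanishing combination by [u]
       leaves [(1 - s) * u ^+ 2 <= 0], so [u] and then [v] vanish. Hence [c] and [d] lie on the line
       [a b]. *)
    have [oc od] : orient (val a) (val b) (val c) = 0 /\ orient (val a) (val b) (val d) = 0.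
      move: nc e; rewrite /cross -leNgt.
      move: (orient _ _ (val c)) (orient _ _ (val d)) => u v uv e.
      have s1' : 0 < 1 - s by rewrite subr_gt0.
      have u0 : u = 0.
        apply/eqP; rewrite -sqrf_eq0 eq_le sqr_ge0 andbT.
        rewrite -(pmulr_rle0 _ s1').
        have -> : (1 - s) * u ^+ 2 = u * ((1 - s) * u + s * v) - s * (u * v) by ring.
        by rewrite e mulr0 sub0r oppr_le0 mulr_ge0// ltW.
      split=> //; move: e; rewrite u0 mulr0 add0r => /eqP.
      by rewrite mulf_eq0 (gt_eqF s0) => /eqP.
    apply: hit_same => //; rewrite aff_neqE//; exact/(line_throughE _ _ _ (val_neq _ _ ab)).
  case/orP => [cr|].
    have /and5P[ab _ _ _ /andP[_ cd]] := cross_neq _ _ _ _ cr.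
    have : line_through (val c) (val d) x0 by rewrite -aff_neqE.
    case=> s es.
    have : line_through (val a) (val b) x0 by rewrite -aff_neqE.
    rewrite (line_throughE _ _ _ (val_neq _ _ ab)) es orient_seg => e.
    rewrite (norm2_seg_lt1 _ _ _ cd).
    move: cr e; rewrite /cross.
    move: (orient _ _ (val c)) (orient _ _ (val d)) => u v uv e.
    have u2 : 0 < u ^+ 2 by rewrite exprn_even_gt0//; apply: contraTneq uv => ->; rewrite mul0r ltxx.
    have v2 : 0 < v ^+ 2 by rewrite exprn_even_gt0//; apply: contraTneq uv => ->; rewrite mulr0 ltxx.
    (* Multiplying by [u] and by [v] shows that [1 - s] and [s] have the same sign; as they add up
       to 1, both are positive. *)
    have eu : (1 - s) * u ^+ 2 + s * (u * v) = 0.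
      by transitivity (u * ((1 - s) * u + s * v)); [ring|rewrite e mulr0].
    have ev : (1 - s) * (u * v) + s * v ^+ 2 = 0.
      by transitivity (v * ((1 - s) * u + s * v)); [ring|rewrite e mulr0].
    by apply/andP; split; nra.
  case/andP => ab h.
  (* A chord taken twice cannot meet itself in a single point, as it contains both [a] and [b]. *)
  have sub : aff a b `<=` [set x0].
    rewrite -hx0; case/orP: h => /andP[/eqP <- /eqP <-]; last rewrite (affC b).
      by rewrite setIid.
    by rewrite setIid.
  case/eqP: ab; apply: val_inj.
  by rewrite (sub _ (aff_l a b)) (sub _ (aff_r a b)).
case: asboolP => [e|ne].
  rewrite lte_fin dist_origin_lt1; last by exists (val a); exact: aff_l.
  split=> [[z abz z1]|h].
    have ab := norm2_lt1_neq _ _ _ abz z1.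
    have cd : c != d by apply: (norm2_lt1_neq _ _ z); rewrite -?e.
    by apply: hit_same => //; rewrite e; [exact: aff_l|exact: aff_r].
  have ab : a != b.
    by case/orP: h => [/cross_neq/andP[]|/andP[]].
  (* The midpoint of the chord lies in the open disc. *)
  exists ((1 - 2^-1) *: val a + 2^-1 *: val b).
    by rewrite aff_neqE//; exists 2^-1.
  by rewrite norm2_seg_lt1// invr_gt0 ltr0n invf_lt1 ?ltr0n// ltr1n.
(* Here [ell] is infinite, so [hit] has to be refuted: crossing chords meet in one point, and a
   chord taken twice gives equal lines. *)
split=> // /orP[cr|/andP[ab h]]; exfalso.
  apply: H; have /and5P[ab _ _ _ /andP[_ cd]] := cross_neq _ _ _ _ cr.
  rewrite !aff_neqE//; move: cr; rewrite /cross.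
  set u := orient _ _ (val c); set v := orient _ _ (val d) => uv.
  have uv0 : u - v != 0 by apply: contraTneq uv => /subr0_eq ->; rewrite -expr2 -leNgt sqr_ge0.
  (* The parameter is the zero of the affine function [(1 - s) * u + s * v] of [s]. *)
  exists ((1 - u / (u - v)) *: val c + (u / (u - v)) *: val d).
  apply/seteqP; split => [z [abz [s es]]|_ ->].
    move: abz; rewrite (line_throughE _ _ _ (val_neq _ _ ab)) es orient_seg -/u -/v => e.
    have -> // : s = u / (u - v).
    apply: (mulIf uv0); rewrite divfK//; apply/eqP; rewrite -subr_eq0; apply/eqP.
    by transitivity (- ((1 - s) * u + s * v)); [ring|rewrite e oppr0].
  split; last by eexists.
  rewrite (line_throughE _ _ _ (val_neq _ _ ab)) orient_seg -/u -/v.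
  by field.
by apply: ne; case/orP: h => /andP[/eqP -> /eqP ->]; rewrite 1?affC.
Qed.

End Geometry.

(** * Iterated integrals and exchange of coordinates *)

Set Implicit Arguments.
Unset Strict Implicit.

(* The product of probabilities is packaged explicitly because unification
   does not find its sigma-finite structure. *)
Definition prob_prod (R : realType) (dX dT : measure_display) (X : measurableType dX)
    (T : measurableType dT) (m : probability X R) (mu : probability T R) : probability (X * T)%type R := (m \x mu)%E.

Lemma integral_prod2 (R : realType) (dX dT : measure_display) (X : measurableType dX)
    (T : measurableType dT) (m : probability X R) (mu : probability T R)
    (F : X * T -> \bar R) : measurable_fun setT F -> (forall z, 0 <= F z)%E ->
  (\int[m \x mu]_z F z = \int[m]_x \int[mu]_y F (x, y))%E.
Proof. exact: (fubini_tonelli1 (m1 := m) (m2 := mu)). Qed.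

Lemma measurable_integral_snd (R : realType) (dX dT : measure_display) (X : measurableType dX)
    (T : measurableType dT) (mu : probability T R)
    (F : X * T -> \bar R) : measurable_fun setT F -> (forall z, 0 <= F z)%E ->
  measurable_fun setT (fun x => \int[mu]_y F (x, y))%E.
Proof. exact: (measurable_fun_fubini_tonelli_F (m2 := mu)). Qed.

Lemma integral_prod3 (R : realType) (dX dT : measure_display) (X : measurableType dX)
    (T : measurableType dT) (m : probability X R) (mu : probability T R)
    (F : X * T * T -> \bar R) : measurable_fun setT F -> (forall z, 0 <= F z)%E ->
  (\int[m \x mu \x mu]_z F z = \int[m]_x \int[mu]_y \int[mu]_z F (x, y, z))%E.
Proof.
move=> mF F0; transitivity (\int[m \x mu]_z \int[mu]_y F (z, y))%E.
  exact: (integral_prod2 (prob_prod m mu) mu).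
have mG := measurable_integral_snd mu mF F0.
by apply: (integral_prod2 m mu mG) => z; apply: integral_ge0.
Qed.

(** Tonelli on the two inner integrals for fixed [x]. Since [X] is arbitrary, this serves both for
    coordinates 3 and 4 of a fourfold product and for coordinates 2 and 3 once the last one is
    integrated out. *)
Lemma integral_swap_last (R : realType) (dX dT : measure_display) (X : measurableType dX)
    (T : measurableType dT) (m : probability X R) (mu : probability T R)
    (F : X * T * T -> \bar R) :
  measurable_fun setT F -> (forall z, 0 <= F z)%E ->
  (\int[m \x mu \x mu]_z F z = \int[m \x mu \x mu]_z F (z.1.1, z.2, z.1.2))%E.
Proof.
move=> mF F0.
have mS : measurable_fun setT (fun z : X * T * T => F (z.1.1, z.2, z.1.2)).
  apply: (measurableT_comp mF); apply: measurable_fun_pair => /=.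
    apply: measurable_fun_pair => //=.
    by apply: measurableT_comp; [exact: measurable_fst|exact: measurable_fst].
  by apply: measurableT_comp; [exact: measurable_snd|exact: measurable_fst].
rewrite (integral_prod3 m mu mF F0) (integral_prod3 m mu mS (fun z => F0 _)).
apply: eq_integral => x _.
apply: (fubini_tonelli (m1 := mu) (m2 := mu) (fun z => F (x, z.1, z.2))) => //=.
apply: (measurableT_comp mF); apply: measurable_fun_pair => //=.
by apply: measurable_fun_pair => //=.
Qed.

(** * Means of functions of four independent points *)

Section Fourfold.
Variables (R : realType) (d : measure_display) (T : measurableType d).
Variable mu : probability T R.
Implicit Types n : T -> T -> T -> T -> nat.

Definition meas4 n := measurable_fun setT
  (fun z : T * T * T * T => (n z.1.1.1 z.1.1.2 z.1.2 z.2)%:R : R).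

Definition mean4 n : \bar R := (\int[mu \x mu \x mu \x mu]_z
  (n z.1.1.1 z.1.1.2 z.1.2 z.2)%:R%:E)%E.

Lemma meas4_perm n (p q r s : T * T * T * T -> T) :
  measurable_fun setT p -> measurable_fun setT q ->
  measurable_fun setT r -> measurable_fun setT s ->
  meas4 n -> measurable_fun setT (fun z => (n (p z) (q z) (r z) (s z))%:R : R).
Proof.
move=> mp mq mr ms mn.
apply: (measurableT_comp (f := fun z : T * T * T * T => (n z.1.1.1 z.1.1.2 z.1.2 z.2)%:R : R)
 (g := fun z => (p z, q z, r z, s z)) mn).
by do 3!apply: measurable_fun_pair => //.
Qed.

Lemma measurable_z1 : measurable_fun setT (fun z : T * T * T * T => z.1.1.1).
Proof. by do 2!(apply: measurableT_comp; first exact: measurable_fst); exact: measurable_fst. Qed.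
Lemma measurable_z2 : measurable_fun setT (fun z : T * T * T * T => z.1.1.2).
Proof.
apply: measurableT_comp; first exact: measurable_snd.
by apply: measurableT_comp; [exact: measurable_fst|exact: measurable_fst].
Qed.
Lemma measurable_z3 : measurable_fun setT (fun z : T * T * T * T => z.1.2).
Proof. by apply: measurableT_comp; [exact: measurable_snd|exact: measurable_fst]. Qed.
Lemma measurable_z4 : measurable_fun setT (fun z : T * T * T * T => z.2).
Proof. exact: measurable_snd. Qed.
#[local] Hint Resolve measurable_z1 measurable_z2 measurable_z3 measurable_z4 : core.

Lemma mean4_swap34 n : meas4 n -> mean4 (fun a b c e => n a b e c) = mean4 n.
Proof.
move=> mn; rewrite /mean4 [RHS](integral_swap_last (prob_prod mu mu) mu)//=.
by apply/measurable_EFinP.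
Qed.

Lemma mean4_swap23 n : meas4 n -> mean4 (fun a b c e => n a c b e) = mean4 n.
Proof.
move=> mn; have mn' : meas4 (fun a b c e => n a c b e).
  by apply: meas4_perm mn.
rewrite /mean4.
have fub k : meas4 k -> (\int[mu \x mu \x mu \x mu]_z (k z.1.1.1 z.1.1.2 z.1.2 z.2)%:R%:E =
    \int[mu \x mu \x mu]_z \int[mu]_e (k z.1.1 z.1.2 z.2 e)%:R%:E)%E.
  move=> mk; apply: (integral_prod2 (prob_prod (prob_prod mu mu) mu) mu (F := fun z : T * T * T * T =>
    (k z.1.1.1 z.1.1.2 z.1.2 z.2)%:R%:E)) => //.
  exact/measurable_EFinP.
rewrite (fub n)// [RHS](integral_swap_last mu mu)//=; last first.
  by move=> z; apply: integral_ge0.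
have mF : measurable_fun setT (fun z : T * T * T * T =>
    (n z.1.1.1 z.1.1.2 z.1.2 z.2)%:R%:E : \bar R) by exact/measurable_EFinP.
  exact: (measurable_integral_snd mu mF).
exact: (fub _ mn').
Qed.

Lemma meas4D n1 n2 : meas4 n1 -> meas4 n2 ->
  meas4 (fun a b c e => n1 a b c e + n2 a b c e)%N.
Proof.
rewrite /meas4 => m1 m2.
under eq_fun do rewrite natrD.
exact: measurable_funD.
Qed.

Lemma mean4D n1 n2 : meas4 n1 -> meas4 n2 ->
  mean4 (fun a b c e => n1 a b c e + n2 a b c e)%N = (mean4 n1 + mean4 n2)%E.
Proof.
move=> m1 m2; rewrite /mean4 -ge0_integralD//=; last 2 first.
- exact/measurable_EFinP.
- exact/measurable_EFinP.
by apply: eq_integral => z _; rewrite natrD EFinD.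
Qed.

Lemma le_mean4 n1 n2 : meas4 n1 -> meas4 n2 ->
  (forall a b c e, n1 a b c e <= n2 a b c e)%N -> (mean4 n1 <= mean4 n2)%E.
Proof.
move=> m1 m2 le; apply: ge0_le_integral => //=.
- exact/measurable_EFinP.
- exact/measurable_EFinP.
- by move=> z _; rewrite lee_fin ler_nat.
Qed.

(** The arguments run over the three ways of splitting four points into two pairs. *)
Definition orbit_sum n := fun a b c e => (n a b c e + n a c b e + n a e b c)%N.

Lemma meas4_orbit n : meas4 n -> meas4 (orbit_sum n).
Proof.
move=> mn; have mn2 : meas4 (fun a b c e => n a c b e) by apply: meas4_perm mn.
have mn3 : meas4 (fun a b c e => n a e b c) by apply: meas4_perm mn.
exact: (meas4D (meas4D mn mn2) mn3).
Qed.

(** Exchangeability: swapping coordinates 2 and 3, then 3 and 4, reaches the other two orderings,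
    and each swap preserves the mean. *)
Lemma mean4_orbit n : meas4 n -> mean4 (orbit_sum n) = (3%:E * mean4 n)%E.
Proof.
move=> mn.
have m1 : meas4 (fun a b c e => n a c b e) by apply: meas4_perm mn.
have m2 : meas4 (fun a b c e => n a e b c) by apply: meas4_perm mn.
rewrite (mean4D (meas4D mn m1) m2) (mean4D mn m1).
rewrite (mean4_swap34 m1) (mean4_swap23 mn).
have -> : (3%:E : \bar R) = (1 + 1 + 1)%E by rewrite -!EFinD; congr EFin; ring.
by rewrite !ge0_muleDl ?adde_ge0// !mul1e.
Qed.

Lemma mean4_cst (k : nat) : mean4 (fun _ _ _ _ => k) = k%:R%:E.
Proof. by rewrite /mean4 integral_cst// [X in (_ * X)%E]probability_setT mule1. Qed.

Lemma measurable_natr_bool : measurable_fun [set: bool] (fun b : bool => b%:R : R).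
Proof. by []. Qed.

Lemma meas4_bool (P : T -> T -> T -> T -> bool) :
  measurable_fun setT (fun z : T * T * T * T => P z.1.1.1 z.1.1.2 z.1.2 z.2) -> meas4 P.
Proof. exact: measurableT_comp measurable_natr_bool. Qed.

Lemma measurable_pred4 (P : T -> T -> T -> T -> bool) :
  measurable_fun setT (fun z : T * T * T * T => P z.1.1.1 z.1.1.2 z.1.2 z.2) ->
  measurable [set z : T * T * T * T | P z.1.1.1 z.1.1.2 z.1.2 z.2].
Proof.
move=> mP; set A := [set _ | _].
have -> : A = setT `&` (fun z : T * T * T * T => P z.1.1.1 z.1.1.2 z.1.2 z.2) @^-1` [set true].
  by rewrite setTI; apply/seteqP; split.
exact: mP.
Qed.

Lemma mean4_bool (P : T -> T -> T -> T -> bool) :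
  measurable_fun setT (fun z : T * T * T * T => P z.1.1.1 z.1.1.2 z.1.2 z.2) ->
  mean4 P = (mu \x mu \x mu \x mu)%E [set z | P z.1.1.1 z.1.1.2 z.1.2 z.2].
Proof.
move=> mP; set A := [set _ | _].
have mA : measurable A by exact: measurable_pred4.
rewrite -[in RHS](setIT A) -integral_indic//.
apply: eq_integral => z _; rewrite indicE.
by congr ((nat_of_bool _)%:R%:E); apply/idP/idP; rewrite inE.
Qed.

Lemma mean4_bool_fin (P : T -> T -> T -> T -> bool) :
  measurable_fun setT (fun z : T * T * T * T => P z.1.1.1 z.1.1.2 z.1.2 z.2) ->
  mean4 P \is a fin_num.
Proof.
move=> mP; rewrite mean4_bool//.
apply: (fin_num_measure (prob_prod (prob_prod (prob_prod mu mu) mu) mu)).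
exact: measurable_pred4.
Qed.

Lemma integral_prob_cst (k : \bar R) : (\int[mu]_x k = k)%E.
Proof. by rewrite integral_cst// [X in (_ * X)%E]probability_setT mule1. Qed.

Lemma mean4E n : meas4 n -> mean4 n =
  (\int[mu]_a \int[mu]_b \int[mu]_c \int[mu]_e (n a b c e)%:R%:E)%E.
Proof.
move=> mn; have mF : measurable_fun setT (fun z : T * T * T * T =>
    (n z.1.1.1 z.1.1.2 z.1.2 z.2)%:R%:E : \bar R) by exact/measurable_EFinP.
have F0 (z : T * T * T * T) :
  (0 <= ((n z.1.1.1 z.1.1.2 z.1.2 z.2)%:R : R)%:E)%E by [].
rewrite /mean4 (integral_prod2 (prob_prod (prob_prod mu mu) mu) mu mF F0).
have mG := measurable_integral_snd mu mF F0.
by apply: (integral_prod3 mu mu mG) => z; apply: integral_ge0.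
Qed.

(** * Point masses and the probabilities of coincidences *)

Hypothesis mdiag : measurable [set z : T * T | z.1 = z.2].

Definition mass (x : T) : \bar R := mu [set x].

Lemma xsection_diag x : xsection [set z : T * T | z.1 = z.2] x = [set x].
Proof. by apply/seteqP; split => y; rewrite /xsection /= inE /= => ->. Qed.

(** A singleton is a section of the measurable diagonal; the same view makes [mass] measurable. *)
Lemma measurable_set1_diag (x : T) : d.-measurable [set x].
Proof. by rewrite -xsection_diag; exact: measurable_xsection. Qed.

Lemma measurable_mass : measurable_fun setT mass.
Proof.
have := measurable_fun_xsection mu mdiag.
by apply: eq_measurable_fun => x _; rewrite /mass /= xsection_diag.
Qed.

Lemma mass_ge0 x : (0 <= mass x)%E. Proof. exact: measure_ge0. Qed.

Lemma mass_fin x : mass x \is a fin_num. Proof. by apply: fin_num_measure; exact: measurable_set1_diag. Qed.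

Lemma integral_eq x : (\int[mu]_y (x == y)%:R%:E = mass x)%E.
Proof.
have mx := measurable_set1_diag x.
rewrite /mass -[in RHS](setIT [set x]) -integral_indic//.
apply: eq_integral => y _; rewrite indicE.
by congr ((nat_of_bool _)%:R%:E); apply/eqP/idP => [->|]; rewrite inE.
Qed.

Lemma measurable_eqb d' (S : measurableType d') (p q : S -> T) :
  measurable_fun setT p -> measurable_fun setT q ->
  measurable_fun setT (fun z => p z == q z).
Proof.
move=> mp mq; apply: (measurable_fun_bool true); rewrite setTI.
have -> : (fun z => p z == q z) @^-1` [set true] =
    setT `&` (fun z => (p z, q z)) @^-1` [set z : T * T | z.1 = z.2].
  by rewrite setTI; apply/seteqP; split => z /= /eqP.
exact: (measurable_fun_pair mp mq).
Qed.

(** The indices count coinciding variables: [s2] is the probability that two independent points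
    agree, [s3] that three do. *)
Definition s2 : \bar R := (\int[mu]_x mass x)%E.
Definition s3 : \bar R := (\int[mu]_x (mass x * mass x))%E.

Lemma natr_andb (b1 b2 : bool) : ((b1 && b2)%:R%:E = b1%:R%:E * b2%:R%:E :> \bar R)%E.
Proof. by rewrite -mulnb natrM EFinM. Qed.

Lemma mean4_eq12 : mean4 (fun a b _ _ => a == b) = s2.
Proof.
rewrite mean4E; last by apply: meas4_bool; exact: measurable_eqb.
apply: eq_integral => a _; rewrite -integral_eq; apply: eq_integral => b _.
by rewrite !integral_prob_cst.
Qed.

Lemma mean4_eq34 : mean4 (fun _ _ c e => c == e) = s2.
Proof.
rewrite mean4E; last by apply: meas4_bool; exact: measurable_eqb.
by rewrite !integral_prob_cst; apply: eq_integral => c _; rewrite integral_eq.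
Qed.

Lemma mean4_pairing : mean4 (fun a b c e => (a == b) && (c == e)) = (s2 * s2)%E.
Proof.
rewrite mean4E; last by apply: meas4_bool; apply: measurable_and; exact: measurable_eqb.
have s20 : (0 <= s2)%E by apply: integral_ge0 => x _; exact: mass_ge0.
rewrite -[RHS]ge0_integralZr//; last exact: measurable_mass.
apply: eq_integral => a _; rewrite -integral_eq -ge0_integralZr//; last first.
  apply/measurable_EFinP; apply: (measurableT_comp measurable_natr_bool).
  exact: measurable_eqb.
apply: eq_integral => b _; rewrite -ge0_integralZl_EFin//; last exact: measurable_mass.
apply: eq_integral => c _; rewrite -integral_eq -ge0_integralZl_EFin//; last first.
  apply/measurable_EFinP; apply: (measurableT_comp measurable_natr_bool).
  exact: measurable_eqb.
by apply: eq_integral => e _; rewrite natr_andb.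
Qed.

Lemma mean4_triple : mean4 (fun a b c e => (a == c) && (a == e)) = s3.
Proof.
rewrite mean4E; last by apply: meas4_bool; apply: measurable_and; exact: measurable_eqb.
apply: eq_integral => a _; rewrite integral_prob_cst.
rewrite -{1}integral_eq -ge0_integralZr//; last first.
  apply/measurable_EFinP; apply: (measurableT_comp measurable_natr_bool).
  exact: measurable_eqb.
apply: eq_integral => c _; rewrite -integral_eq -ge0_integralZl_EFin//; last first.
  apply/measurable_EFinP; apply: (measurableT_comp measurable_natr_bool).
  exact: measurable_eqb.
by apply: eq_integral => e _; rewrite natr_andb.
Qed.

Lemma s2_fin_num : s2 \is a fin_num.
Proof.
rewrite ge0_fin_numE; last by apply: integral_ge0 => x _; exact: mass_ge0.
apply: (@le_lt_trans _ _ 1%E); last exact: ltry.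
rewrite -[leRHS]integral_prob_cst; apply: ge0_le_integral => //.
- exact: measurable_mass.
- by move=> x _; apply: probability_le1; exact: measurable_set1_diag.
Qed.

(* Jensen's inequality, from [2 s x <= x^2 + s^2]. *)
Lemma s2_sq_le_s3 : (s2 * s2 <= s3)%E.
Proof.
have s2fin := s2_fin_num; pose s := fine s2.
have s0 : 0 <= s by apply: fine_ge0; apply: integral_ge0 => x _; exact: mass_ge0.
have mm2 : measurable_fun setT (fun x => mass x * mass x)%E.
  by apply: emeasurable_funM; exact: measurable_mass.
have mm0 x : (0 <= mass x * mass x)%E by rewrite mule_ge0 ?mass_ge0.
have le : ((s *+ 2)%:E * s2 <= s3 + (s * s)%:E)%E.
  rewrite -[X in (_ + X)%E]integral_prob_cst -ge0_integralD//; last first.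
    by move=> x _; rewrite lee_fin mulr_ge0.
  rewrite -ge0_integralZl_EFin//; last 2 first.
  - exact: measurable_mass.
  - by rewrite mulrn_wge0.
  apply: ge0_le_integral => //.
  - by move=> x _; rewrite mule_ge0 ?mass_ge0// lee_fin mulrn_wge0.
  - by apply: measurable_funeM; exact: measurable_mass.
  - exact: emeasurable_funD.
  - move=> x _; rewrite -(fineK (mass_fin x)) -!EFinM -EFinD lee_fin.
    by have := sqr_ge0 (fine (mass x) - s); rewrite -mulr_natr; nra.
have s30 : (0 <= s3)%E by apply: integral_ge0.
move: le s30; rewrite -(fineK s2fin) -/s -!EFinM; case: s3 => [r| |]//=.
- by rewrite -EFinD !lee_fin -mulr_natr; nra.
- by move=> _ _; rewrite leey.
Qed.

(** The event contains the fourth power of [[set p]]. This turns a null probability of full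
    coincidence into the absence of atoms. *)
Lemma le_mean4_all_eq p :
  (mass p * mass p * mass p * mass p <= mean4 (fun a b c e => [&& a == b, a == c & a == e]))%E.
Proof.
rewrite mean4_bool; last by do 2?apply: measurable_and; exact: measurable_eqb.
have mp := measurable_set1_diag p.
have <- : (mu \x mu \x mu \x mu)%E ([set p] `*` [set p] `*` [set p] `*` [set p]) =
    (mass p * mass p * mass p * mass p)%E.
  have mp2 := measurableX mp mp.
  etransitivity.
    exact: (product_measure1E (prob_prod (prob_prod mu mu) mu) mu (measurableX mp2 mp) mp).
  congr (_ * _)%E; etransitivity.
    exact: (product_measure1E (prob_prod mu mu) mu mp2 mp).
  by congr (_ * _)%E; exact: product_measure1E.
apply: (le_measure (prob_prod (prob_prod (prob_prod mu mu) mu) mu)); rewrite ?inE.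
- by do 3!apply: measurableX => //.
- apply: (measurable_pred4 (P := fun a b c e => [&& a == b, a == c & a == e])).
  by do 2?apply: measurable_and; exact: measurable_eqb.
- by move=> [[[a b] c] e] /= [[[-> ->] ->] ->]; rewrite !eqxx.
Qed.

(** * Averaging the pointwise inequalities *)

Variable H : T -> T -> T -> T -> bool.
Hypothesis mH : measurable_fun setT (fun z : T * T * T * T => H z.1.1.1 z.1.1.2 z.1.2 z.2).

Lemma mean4_upper :
  (forall a b c e, orbit_sum (fun a b c e => H a b c e + ((a == c) && (a == e)))%N a b c e
     + [&& a == b, a == c & a == e]
   <= 1 + orbit_sum (fun a b c e => (a == b) && (c == e)) a b c e)%N ->
  (mean4 H <= (3^-1)%:E)%E /\
  (mean4 H = (3^-1)%:E -> forall p, mu [set p] = 0%E).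
Proof.
move=> hyp.
have mT : measurable_fun setT (fun z : T * T * T * T => (z.1.1.1 == z.1.2) && (z.1.1.1 == z.2)).
  by apply: measurable_and; exact: measurable_eqb.
have mJ : measurable_fun setT (fun z : T * T * T * T =>
    [&& z.1.1.1 == z.1.1.2, z.1.1.1 == z.1.2 & z.1.1.1 == z.2]).
  by do 2?apply: measurable_and; exact: measurable_eqb.
have mQ : measurable_fun setT (fun z : T * T * T * T => (z.1.1.1 == z.1.1.2) && (z.1.2 == z.2)).
  by apply: measurable_and; exact: measurable_eqb.
have m4H := meas4_bool mH.
have m4T := meas4_bool (P := fun a b c e => (a == c) && (a == e)) mT.
have m4J := meas4_bool (P := fun a b c e => [&& a == b, a == c & a == e]) mJ.
have m4Q := meas4_bool (P := fun a b c e => (a == b) && (c == e)) mQ.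
have m4HT := meas4D m4H m4T.
have m1 : meas4 (fun _ _ _ _ => 1%N) by exact: measurable_cst.
have := le_mean4 (meas4D (meas4_orbit m4HT) m4J) (meas4D m1 (meas4_orbit m4Q)) hyp.
rewrite (mean4D (meas4_orbit m4HT) m4J) (mean4D m1 (meas4_orbit m4Q)).
rewrite (mean4_orbit m4HT) (mean4_orbit m4Q) (mean4D m4H m4T) mean4_cst mean4_pairing.
rewrite mean4_triple => le.
have := s2_sq_le_s3.
have := mean4_bool_fin (P := fun a b c e => (a == c) && (a == e)) mT; rewrite mean4_triple => s3fin.
have := le_mean4_all_eq.
have := mean4_bool_fin (P := fun a b c e => [&& a == b, a == c & a == e]) mJ.
have := mean4_bool_fin mH.
move: le; set h := mean4 H; set j := mean4 _.
move=> + hfin jfin pj.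
(* All four quantities are finite, so the inequalities can be read in [R], where [s3] cancels
   against the square of [s2]. *)
rewrite -(fineK hfin) -(fineK jfin) -(fineK s2_fin_num) -(fineK s3fin).
have j0 : (0 <= j)%E by apply: integral_ge0.
have j0' := fine_ge0 j0.
rewrite -!EFinM -!EFinD !lee_fin => le1 le2; split; first by lra.
move=> [h3].
(* What is left is [3 * h + j <= 1], so [h = 1/3] leaves no room for [j]. *)
have jle : fine j <= 0 by nra.
move=> p; have := pj p; have := mass_ge0 p.
rewrite -(fineK jfin) -[mu [set p]]/(mass p) -(fineK (mass_fin p)) -!EFinM !lee_fin.
set m := fine _ => m0 m4; congr EFin; apply/eqP.
suff : m ^+ 4 == 0 by rewrite expf_eq0 => /andP[].
rewrite eq_le exprn_ge0// andbT.
by apply: le_trans jle; apply: le_trans m4; rewrite !exprS expr0 mulr1 !mulrA.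
Qed.

(** Averaging gives [1 <= 3 * (mean4 H + s2 + s2)], and [s2] vanishes without atoms. *)
Lemma mean4_lower :
  (forall a b c e, 1 <= orbit_sum (fun a b c e => H a b c e + (a == b) + (c == e)) a b c e)%N ->
  (forall p, mu [set p] = 0%E) -> ((3^-1)%:E <= mean4 H)%E.
Proof.
move=> hyp mu0.
have m4H := meas4_bool mH.
have m12 : meas4 (fun a b _ _ => a == b) by apply: meas4_bool; exact: measurable_eqb.
have m34 : meas4 (fun _ _ c e => c == e) by apply: meas4_bool; exact: measurable_eqb.
have m1 : meas4 (fun _ _ _ _ => 1%N) by exact: measurable_cst.
have mG := meas4D (meas4D m4H m12) m34.
have := le_mean4 m1 (meas4_orbit mG) hyp.
rewrite mean4_cst (mean4_orbit mG) (mean4D (meas4D m4H m12) m34) (mean4D m4H m12).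
rewrite mean4_eq12 mean4_eq34.
have -> : s2 = 0%E by rewrite /s2 integral0_eq// => x _; exact: mu0.
by rewrite !adde0 -(fineK (mean4_bool_fin mH)) -EFinM !lee_fin; lra.
Qed.

End Fourfold.

(** * Measurability on the circle *)

Section CircleMeasurability.
Variable R : realType.

Lemma continuous_measurable_circle (f : circle R -> R) : continuous f ->
  measurable_fun setT (f : borel_circle R -> R).
Proof.
move=> /continuousP cf; apply: (measurability _ (RGenOpens.measurableE R)).
move=> _ [_ [a [b ->] <-]]; rewrite setTI.
by apply: sub_sigma_algebra; apply: cf; exact: interval_open.
Qed.

Lemma measurable_fst_circle :
  measurable_fun setT (fun p : borel_circle R => (val (p : circle R)).1).
Proof.
apply: (@continuous_measurable_circle (fun p => (val p).1)) => p.
apply: (@continuous_comp _ _ _ (fun p : circle R => val p) fst).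
  exact: initial_continuous.
exact: cvg_fst.
Qed.

Lemma measurable_snd_circle :
  measurable_fun setT (fun p : borel_circle R => (val (p : circle R)).2).
Proof.
apply: (@continuous_measurable_circle (fun p => (val p).2)) => p.
apply: (@continuous_comp _ _ _ (fun p : circle R => val p) snd).
  exact: initial_continuous.
exact: cvg_snd.
Qed.

Lemma measurable_circle_coord d (T : measurableType d) (p : T -> borel_circle R) :
  measurable_fun setT p ->
  measurable_fun setT (fun t => (val (p t : circle R)).1) /\
  measurable_fun setT (fun t => (val (p t : circle R)).2).
Proof.
move=> mp; split.
  exact: (measurableT_comp measurable_fst_circle mp).
exact: (measurableT_comp measurable_snd_circle mp).
Qed.

(** Equality of the two real coordinates cuts out the diagonal, which places it in the product of
    the Borel sigma-algebras. *)
Lemma measurable_circle_diag :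
  measurable [set z : borel_circle R * borel_circle R | z.1 = z.2].
Proof.
have [m1 m2] := measurable_circle_coord (@measurable_fst _ _ (borel_circle R) (borel_circle R)).
have [m3 m4] := measurable_circle_coord (@measurable_snd _ _ (borel_circle R) (borel_circle R)).
have := measurable_and (measurable_fun_eqr m1 m3) (measurable_fun_eqr m2 m4).
move=> /(_ measurableT [set true] _); rewrite setTI => h.
have e (B C : set (borel_circle R * borel_circle R)) : B = C -> measurable B -> measurable C.
  by move=> ->.
apply: e (h _) => //; apply/seteqP; split => -[x y] /=; last by move=> ->; rewrite !eqxx.
move=> /andP[/eqP e1 /eqP e2]; apply: val_inj; move: e1 e2 => /=.
by case: (sval x) (sval y) => [? ?] [? ?] /= -> ->.
Qed.

Lemma measurable_hit : measurable_fun setT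
  (fun z : borel_circle R * borel_circle R * borel_circle R * borel_circle R =>
     hit R z.1.1.1 z.1.1.2 z.1.2 z.2).
Proof.
have mo (p q r : borel_circle R * borel_circle R * borel_circle R * borel_circle R -> borel_circle R) :
    measurable_fun setT p -> measurable_fun setT q -> measurable_fun setT r ->
    measurable_fun setT (fun z => orient (val (p z : circle R)) (val (q z : circle R)) (val (r z : circle R))).
  move=> /measurable_circle_coord[p1 p2] /measurable_circle_coord[q1 q2].
  move=> /measurable_circle_coord[r1 r2].
  by apply: measurable_funB; apply: measurable_funM; apply: measurable_funB.
have D := measurable_circle_diag.
have m1 := @measurable_z1 _ (borel_circle R).
have m2 := @measurable_z2 _ (borel_circle R).
have m3 := @measurable_z3 _ (borel_circle R).
have m4 := @measurable_z4 _ (borel_circle R).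
have eqb := measurable_eqb D.
have h1 : measurable_fun setT
    (fun z : borel_circle R * borel_circle R * borel_circle R * borel_circle R =>
    cross R z.1.1.1 z.1.1.2 z.1.2 z.2).
  apply: measurable_fun_ltr; last exact: measurable_cst.
  exact: (measurable_funM (mo _ _ _ m1 m2 m3) (mo _ _ _ m1 m2 m4)).
exact: (measurable_or h1 (measurable_and (measurable_neg (eqb _ _ _ _ m1 m2))
  (measurable_or (measurable_and (eqb _ _ _ _ m1 m3) (eqb _ _ _ _ m2 m4))
    (measurable_and (eqb _ _ _ _ m1 m4) (eqb _ _ _ _ m2 m3))))).
Qed.

(** * An atomless probability measure on the circle *)

(** The rational parametrization of the circle minus [(-1, 0)], inverse to stereographic projection
    from that point. *)
Definition cayley_fun (t : R) : R * R :=
  ((1 - t ^+ 2) / (1 + t ^+ 2), 2 * t / (1 + t ^+ 2)).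

Lemma cayley_den_gt0 (t : R) : 0 < 1 + t ^+ 2.
Proof. by rewrite ltr_pwDl ?sqr_ge0. Qed.

Lemma cayley_circle t : unit_circle R (cayley_fun t).
Proof.
have h : 1 + t ^+ 2 != 0 by rewrite gt_eqF ?cayley_den_gt0.
rewrite /unit_circle /enorm2 /= -[RHS]sqrtr1; congr Num.sqrt.
by field.
Qed.

Definition cayley (t : R) : circle R := SigSub (mem_set (cayley_circle t)).

Lemma cayley_inj : injective cayley.
Proof.
move=> s t /(congr1 val) /= [].
have := cayley_den_gt0 s; have := cayley_den_gt0 t.
set a := 1 + s ^+ 2; set b := 1 + t ^+ 2 => b0 a0 e1 e2.
(* In this form the first coordinate determines [1 + t ^+ 2]; the second one then determines [t]. *)
have ea : (1 - s ^+ 2) / a = 2 / a - 1.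
  by rewrite /a in a0 *; field; rewrite gt_eqF.
have eb : (1 - t ^+ 2) / b = 2 / b - 1.
  by rewrite /b in b0 *; field; rewrite gt_eqF.
have e3 : a^-1 = b^-1 by move: e1; rewrite ea eb; lra.
have bI : b^-1 != 0 by rewrite invr_eq0 gt_eqF.
by move: e2; rewrite e3 => /(mulIf bI); lra.
Qed.

Lemma measurable_cayley : measurable_fun setT (cayley : R -> borel_circle R).
Proof.
apply: (@measurability _ _ _ (borel_circle R) setT cayley (@open (circle R)) erefl).
move=> _ [B oB <-]; rewrite setTI; apply: open_measurable.
suff /continuousP : continuous cayley by apply.
apply: continuous_comp_initial => t.
have h : 1 + t ^+ 2 != 0 by rewrite gt_eqF ?cayley_den_gt0.
have cX : {for t, continuous (fun s : R => s ^+ 2)} by exact: exprn_continuous.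
have cI : {for t, continuous (fun s : R => (1 + s ^+ 2)^-1)}.
  by apply: cvgV => //; apply: cvgD; [exact: cvg_cst|exact: cX].
have c1 : {for t, continuous (fun s : R => (1 - s ^+ 2) / (1 + s ^+ 2))}.
  by apply: cvgM => //; apply: cvgB; [exact: cvg_cst|exact: cX].
have c2 : {for t, continuous (fun s : R => 2 * s / (1 + s ^+ 2))}.
  by apply: cvgM => //; apply: cvgM; [exact: cvg_cst|exact: cvg_id].
exact: (cvg_pair c1 c2).
Qed.

(** The image of the uniform law on [[0, 1]] under [cayley]: by injectivity the preimage of a point
    is empty or a singleton, hence null. *)
Lemma exists_atomless : exists mu : probability (borel_circle R) R,
  forall p : borel_circle R, mu [set p] = 0%E.
Proof.
have mc : measurable_fun setT (cayley : measurableTypeR R -> borel_circle R).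
  by move=> _ Y mY; exact: (measurable_cayley measurableT mY).
pose P : probability (measurableTypeR R) R := uniform_prob (@ltr01 R).
pose X : {mfun measurableTypeR R >-> borel_circle R} := mfun_Sub (mem_set mc).
exists (distribution P X) => p.
have mp : measurable [set p] by exact: (measurable_set1_diag measurable_circle_diag).
have [[t et]|np] := pselect (exists t, cayley t = p).
  transitivity (P [set t]).
    congr (P _); apply/seteqP; split => s /=; last by move=> ->.
    by rewrite -et => /cayley_inj.
  have /null_content_dominatesP := dominates_uniform_prob (@ltr01 R).
  by apply => //; exact: lebesgue_measure_set1.
transitivity (P set0); last exact: measure0.
by congr (P _); apply/seteqP; split => s //= e; apply: np; exists s.
Qed.

End CircleMeasurability.

(** * Application to [ell] and the supremum *)

Lemma prob_ell_lt1E (R : realType) (mu : probability (borel_circle R) R) :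
  prob_ell_lt mu 1 = mean4 mu (hit R).
Proof.
rewrite mean4_bool; last exact: measurable_hit.
rewrite /prob_ell_lt; congr (_ _).
by apply/seteqP; split => z /ell_lt1.
Qed.

Lemma prob_ell_lt1_le (R : realType) (mu : probability (borel_circle R) R) :
  (prob_ell_lt mu 1 <= (3^-1)%:E)%E /\
  (prob_ell_lt mu 1 = (3^-1)%:E -> forall p : borel_circle R, mu [set p] = 0%E).
Proof.
rewrite prob_ell_lt1E.
have := @mean4_upper R _ (borel_circle R) mu (@measurable_circle_diag R) (hit R) (@measurable_hit R).
apply => a b c e.
exact: hit_le.
Qed.

Lemma prob_ell_lt1_atomless (R : realType) (mu : probability (borel_circle R) R) :
  (forall p : borel_circle R, mu [set p] = 0%E) -> prob_ell_lt mu 1 = (3^-1)%:E.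
Proof.
move=> mu0; apply/eqP; rewrite eq_le (prob_ell_lt1_le mu).1 prob_ell_lt1E.
have := @mean4_lower R _ (borel_circle R) mu (@measurable_circle_diag R) (hit R) (@measurable_hit R).
apply => // a b c e.
exact: le_hit.
Qed.

Theorem theorem1p2 (R : realType) :
  sup_prob (1 : R) = (3^-1)%:E /\
  forall mu : probability (borel_circle R) R,
    prob_ell_lt mu 1 = (3^-1)%:E <->
    forall p : borel_circle R, mu [set p] = 0%E.
Proof.
split; last first.
  move=> mu; split; first exact: (prob_ell_lt1_le mu).2.
  exact: prob_ell_lt1_atomless.
apply/eqP; rewrite eq_le; apply/andP; split.
  by apply: ge_ereal_sup => _ [mu _ <-]; exact: (prob_ell_lt1_le mu).1.
(* The supremum is attained, at any atomless measure. *)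
have [mu mu0] := exists_atomless R.
by apply: ereal_sup_ubound; exists mu => //; exact: prob_ell_lt1_atomless.
Qed.
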